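(* There exists an ultrafilter $\mathcal{U}\subseteq 2^\omega$ on $\omega$ that is not a $\mathrm{P}$-point and that has a subset $A\subseteq\mathcal{U}$ which is closed in $\mathcal{U}$, has cardinality $\mathfrak{c}$, and, as a subset of $2^\omega$, does not have the perfect set property.
   Context: Every subset of $\omega$ is identified with its characteristic function, so an ultrafilter on $\omega$ is regarded as a subset of the Cantor set $2^\omega$ and carries the subspace topology. $\mathfrak{c}=2^{\aleph_0}$. For $x,y\subseteq\omega$, $x\subseteq^\ast y$ means that $x\setminus y$ is finite; a pseudointersection of $\mathcal{C}\subseteq\mathcal{P}(\omega)$ is a set $x\subseteq\omega$ such that $x\subseteq^\ast y$ for all $y\in\mathcal{C}$. A $\mathrm{P}$-point is a non-principal ultrafilter $\mathcal{U}$ on $\omega$ such that every countable $\mathcal{C}\subseteq\mathcal{U}$ has a pseudointersection in $\mathcal{U}$. A perfect set in $2^\omega$ is a non-empty closed subset of $2^\omega$ with no isolated points (equivalently, a subset homeomorphic to $2^\omega$). A set $A\subseteq 2^\omega$ has the perfect set property if $A$ is either countable or contains a perfect set in $2^\omega$. *)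

(* Defs.v *)
From mathcomp Require Import all_boot all_classical topology cantor.

Set Implicit Arguments.
Unset Strict Implicit.
Unset Printing Implicit Defensive.

Local Open Scope classical_set_scope.

Definition charf (x : set nat) : cantor_space := fun n => n \in x.

Definition in_cantor (U : set_system nat) : set cantor_space := charf @` U.

Definition almost_subset (x y : set nat) : Prop := finite_set (x `\` y).

Definition pseudointersection (C : set_system nat) (x : set nat) : Prop :=
  forall y, C y -> almost_subset x y.

Definition nonprincipal (U : set_system nat) : Prop :=
  forall n : nat, U <> principal_filter n.

Definition P_point (U : set_system nat) : Prop :=
  [/\ UltraFilter U,
      nonprincipal U
    & forall C : set_system nat, countable C -> C `<=` U ->
        exists2 x, U x & pseudointersection C x].

(* The library's perfect_set holds of set0, hence the condition P !=set0. *)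
Definition perfect_set_property (A : set cantor_space) : Prop :=
  countable A \/
  exists P : set cantor_space, [/\ P !=set0, perfect_set P & P `<=` A].

(* For A included in B, the library's topology on the type subspace B, which
   additionally makes the points outside B isolated, gives that A is closed
   exactly when A is the trace on B of a closed set. *)
Definition closed_in (B A : set cantor_space) : Prop :=
  A `<=` B /\ closed (A : set (subspace B)).

Definition has_card_continuum (A : set cantor_space) : Prop :=
  (A #= [set: set nat])%card.

(* Main.v *)
Require Import Defs.
From mathcomp Require Import all_boot all_classical wochoice topology cantor.

(** Let [Phi] embed the Cantor space continuously onto a closed set of
    characteristic functions of sets forming an independent family: all finite
    Boolean combinations of the [indep f] are infinite
    ([indep_independent]).  By independence, any prescription of which of the
    [indep f] are in and which are out is realised by some ultrafilter.
    Prescribe a Bernstein-like set [B] of size continuum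
    ([bernstein_indep]): the ultrafilter [U] then meets the closed set
    [range Phi] exactly in [Phi @` B], which is therefore closed in [U].  It has
    the size of the continuum, so it is uncountable, and it contains no perfect
    set.

    The ultrafilter must moreover fail to be a P-point.  Fix a countably
    infinite [E `<=` B] and also put into the filter the complements of all the
    pseudointersections of [indep @` E].  The finite intersection property
    survives: a finite Boolean combination only involves finitely many indices,
    so it can be cut down to the infinite set of its points outside [indep g]
    for some unused [g] in [E], and a pseudointersection covers only finitely
    many of these points ([indep_ultrafilter]).

    The set [B] comes from a well-order whose proper initial segments are all
    smaller than the continuum.  Along it one picks pairwise distinct points of
    prescribed sets of size continuum ([injective_transversal]); each perfect
    set is presented twice, and one of its two points goes to [B] while the
    other is kept out of [B] ([bernstein]).  This requires perfect sets to have
    the size of the continuum ([perfect_set_card]), and a closed set to be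
    coded by a single point of the Cantor space, namely by the set of the
    finite initial segments of its members. *)

Set Implicit Arguments.
Unset Strict Implicit.

Local Open Scope classical_set_scope.
Local Open Scope card_scope.

(** * Transversals and Bernstein sets *)

Lemma setT_card_leP (I T : Type) (B : set T) :
  [set: I] #<= B <-> exists2 f : I -> T, injective f & forall i, B (f i).
Proof.
split=> [/card_leP[f]|[f finj fB]]; last first.
  apply: (@card_le_trans _ _ _ (range f)).
    by rewrite (card_le_eqr (inj_card_eq _)) //; exact: in2W.
  by apply: subset_card_le => _ [i _ <-].
exists (fun i => val (f (to_setT i))) => [i j /val_inj fij|i].
  have /(congr1 val) // : to_setT i = to_setT j.
  by apply: (inj (f := f)); rewrite ?inE.
exact: set_valP.
Qed.

(** This plays the role of the initial ordinal of the cardinal of [I].  If some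
    initial segment of an arbitrary well-order is as large as [I], then [I]
    embeds into the least such segment, all of whose own initial segments are
    smaller, and the order can be pulled back along this embedding. *)
Lemma small_segments_order (I : eqType) :
  exists lt : I -> I -> Prop,
    [/\ well_founded lt,
        forall i j, i <> j -> lt i j \/ lt j i
      & forall i, ~ ([set: I] #<= [set j | lt j i])].
Proof.
have [R Rwo] := well_ordering_principle I.
have Rch : wo_chain R (@predT I) by move=> A _; exact: Rwo.
have Ranti i j : R i j && R j i -> i = j.
  by apply: (wo_chain_antisymmetric Rch).
pose lt i j := ~~ R j i.
have min (A : set I) : A !=set0 -> exists2 z, A z & forall x, A x -> ~ lt x z.
  move=> [a Aa].
  have [|z [[zA zmin] _]] := Rwo (mem A); first by exists a; rewrite inE.
  exists z; first by move: zA; rewrite inE.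
  by move=> x Ax; rewrite /lt zmin // inE.
have wf : well_founded (lt : I -> I -> Prop).
  move=> i; apply: contrapT => nacc.
  have [z nz zmin] := min [set i | ~ Acc lt i] (ex_intro _ i nacc).
  by apply: nz; constructor => y yz; apply: contrapT => /zmin; exact.
have tri i j : i <> j -> lt i j \/ lt j i.
  move=> ij; rewrite /lt; case/boolP: (R j i) => [Rji|]; last by left.
  by right; apply/negP => Rij; apply: ij; apply: Ranti; rewrite Rij.
have [big|/forallNP small] :=
    pselect (exists i, [set: I] #<= [set j | lt j i]); last first.
  by exists lt.
have [z zbig zmin] := min [set i | [set: I] #<= [set j | lt j i]] big.
have /setT_card_leP[g ginj gz] := zbig.
exists (fun i j => lt (g i) (g j)); split.
- move=> i; move gi: (g i) => k.
  elim: (wf k) i gi => {}k _ IHk i gi.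
  by constructor => j; rewrite gi => /IHk; apply.
- by move=> i j ij; apply: tri => /ginj.
- move=> i /setT_card_leP[h hinj hi]; apply: (zmin (g i)); last exact: gz.
  apply/setT_card_leP; exists (g \o h) => //.
  exact: inj_comp.
Qed.

(** The points are chosen by transfinite recursion: the fewer than [#|I|]
    points chosen before stage [i] cannot exhaust [P i]. *)
Lemma injective_transversal (I : eqType) (T : pointedType) (P : I -> set T) :
  (forall i, [set: I] #<= P i) ->
  exists2 p : I -> T, injective p & forall i, P i (p i).
Proof.
move=> Pbig; have [lt [wf tri small]] := small_segments_order I.
pose step i (rec : forall j, lt j i -> T) : T :=
  get (P i `\` [set x | exists j (ji : lt j i), x = rec j ji]).
pose p := Fix wf (fun=> T) step.
have pE i : p i = get (P i `\` p @` [set j | lt j i]).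
  rewrite /p Fix_eq; last first.
    move=> {}i f g fg; rewrite (_ : f = g) //.
    by apply: functional_extensionality_dep => j; apply: funext => ji.
  rewrite /step; congr (get (_ `\` _)); apply/seteqP.
  by split=> x /= => [[j [ji ->]]|[j ji <-]]; exists j => //; exists ji.
have pP i : (P i `\` p @` [set j | lt j i]) (p i).
  rewrite pE; apply: getPex; apply: contrapT => /forallNP none.
  apply: (small i); apply: card_le_trans (Pbig i) _.
  apply: card_le_trans (card_image_le p _); apply: subset_card_le => x Px.
  by apply: contrapT => px; exact: (none x).
exists p; last by move=> i; have [] := pP i.
move=> i j pij; apply: contrapT => /tri[] lij.
  by have [_ []] := pP j; exists i.
by have [_ []] := pP i; exists j.
Qed.

(** In a transversal of the family in which every [P i] occurs twice, the
    points indexed by [true] form [B], and the point of [P i] indexed by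
    [false] shows that [P i] is not included in [B]. *)
Lemma bernstein (I : eqType) (T : pointedType) (P : I -> set T) :
  (forall i, [set: bool * I] #<= P i) ->
  exists2 B : set T, [set: I] #<= B & forall i, ~ P i `<=` B.
Proof.
move=> Pbig.
have [//|p pinj pP] := @injective_transversal _ T (fun bi : bool * I => P bi.2).
exists (range (fun i => p (true, i))).
  by apply/setT_card_leP; exists (fun i => p (true, i)) => // i j /pinj[].
by move=> i /(_ (p (false, i)) (pP (false, i)))[j _ /pinj].
Qed.

(** * The Cantor space and its perfect subsets *)

Definition cylinder (f : cantor_space) n : set cantor_space :=
  [set g | forall k, k < n -> g k = f k].

Lemma nbhs_cylinder f n : nbhs f (cylinder f n).
Proof.
elim: n => [|n IHn]; first by apply: filterS filterT => g _ k.
have fn : nbhs f [set g : cantor_space | g n = f n].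
  by apply: (@proj_continuous nat (fun=> bool) n f [set f n]).
apply: filterS (filterI IHn fn) => g [gf gn] k.
by rewrite ltnS leq_eqVlt => /predU1P[->//|]; exact: gf.
Qed.

Lemma cvg_coord (F : set_system cantor_space) (f : cantor_space) :
  Filter F -> (forall n, F [set g | g n = f n]) -> F --> f.
Proof.
move=> FF Ff; apply/cvg_sup => n U [V [[W oW <-] WfN] WU].
by apply: filterS (Ff n) => g gn; apply: WU; rewrite /= gn.
Qed.

Lemma cylinder_nbhs f (V : set cantor_space) :
  nbhs f V -> exists n, cylinder f n `<=` V.
Proof.
(* The filter generated by the cylinders around f converges to f. *)
have FF : Filter (filter_from [set: nat] (cylinder f)).
  apply: filter_from_filter; first by exists 0.
  move=> i j _ _; exists (maxn i j) => // g gf.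
  by split=> k ki; apply: gf; rewrite leq_max ki ?orbT.
move=> fV; suff /(_ V fV)[n _ nV] : filter_from [set: nat] (cylinder f) --> f.
  by exists n.
by apply: cvg_coord => n; exists n.+1 => // g; exact.
Qed.

Lemma closed_cylinder (P : set cantor_space) f : closed P ->
  (forall n, exists2 g, P g & cylinder f n g) -> P f.
Proof.
move=> cP fP; apply: cP => V /cylinder_nbhs[n nV].
by have [g Pg gf] := fP n; exists g; split => //; exact: nV.
Qed.

(** A Cantor scheme.  Its nodes are pairs [(u, n)] of a point [u] of [P] and a
    length [n], standing for the initial segment of [u] of length [n].  As [u]
    is not isolated in [P], another point [h] of [P] has the same initial
    segment and first differs from [u] at some [m >= n]; the two sons of the
    node are [(u, m.+1)] and [(h, m.+1)].  A branch [g] of the scheme determines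
    a point [L g], which lies in [P] because [P] is closed, and distinct
    branches determine distinct points because the sons of a node are
    incompatible. *)
Lemma perfect_set_card (P : set cantor_space) :
  P !=set0 -> perfect_set P -> [set: cantor_space] #<= P.
Proof.
move=> [f0 Pf0] [cP lP].
have split (u : cantor_space * nat) : exists hm : cantor_space * nat, P u.1 ->
    [/\ P hm.1, cylinder u.1 u.2 hm.1, u.2 <= hm.2 & hm.1 hm.2 != u.1 hm.2].
  have [Pu|nPu] := pselect (P u.1); last by exists u.
  have : limit_point P u.1 by rewrite lP.
  move=> /(_ _ (nbhs_cylinder u.1 u.2))[h [hu Ph uh]].
  have [m hm] : exists m, h m <> u.1 m.
    by apply/existsNP => hu'; move/eqP: hu; apply; exact: funext.
  exists (h, m) => _; split => //; last exact/eqP.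
  by rewrite leqNgt; apply/negP => /uh.
have [s sP] := choice split.
pose next u (b : bool) := (if b then (s u).1 else u.1, (s u).2.+1).
pose st (g : cantor_space) n := iteri n (fun k u => next u (g k)) (f0, 0).
have stS g n : st g n.+1 = next (st g n) (g n) by [].
have stP g n : P (st g n).1.
  elim: n => // n IHn; rewrite stS /next /=.
  by case: (g n) => //; have [] := sP _ IHn.
have stlt g n : (st g n).2 < (st g n.+1).2.
  by rewrite stS /= ltnS; have [] := sP _ (stP g n).
have stge g n : n <= (st g n).2.
  by elim: n => // n IHn; exact: leq_ltn_trans (stlt g n).
have stcyl1 g n : cylinder (st g n).1 (st g n).2 (st g n.+1).1.
  by rewrite stS /=; case: (g n) => //; have [] := sP _ (stP g n).
have stcyl g n m : n <= m -> cylinder (st g n).1 (st g n).2 (st g m).1.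
  move=> /subnKC <-; elim: (m - n) => [|d IHd]; first by rewrite addn0.
  rewrite addnS => k kn; rewrite stcyl1 ?IHd //; apply: leq_trans kn _.
  elim: d {IHd} => [|d]; first by rewrite addn0.
  by rewrite addnS => /leq_trans; apply; exact: ltnW.
(* The node at depth k.+1 has length greater than k, so it decides L g k. *)
pose L g : cantor_space := fun k => (st g k.+1).1 k.
have Lcyl g n : cylinder (st g n).1 (st g n).2 (L g).
  move=> k kn; rewrite /L; have [nk|kn'] := leqP n k.+1.
    by rewrite (stcyl g n).
  by rewrite -(@stcyl g k.+1 n) ?(ltnW kn') // (leq_trans _ (stge _ _)).
apply/setT_card_leP; exists L; last first.
  move=> g; apply: closed_cylinder => // n; exists (st g n).1 => //.
  by move=> k kn; rewrite (@Lcyl g n) // (leq_trans kn).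
move=> g g' Lgg; apply: funext => n; elim/ltn_ind: n => n IHn.
have stE : st g n = st g' n.
  elim: n IHn => // n IH IHn; rewrite !stS IHn // IH // => k kn.
  by apply: IHn; exact: ltnW.
have [_ _ _ /eqP sn] := sP _ (stP g n).
apply: contrapT => gn; apply: sn.
have := @Lcyl g n.+1 (s (st g n)).2; have := @Lcyl g' n.+1 (s (st g' n)).2.
rewrite !stS /= !ltnS !leqnn Lgg -stE => /(_ isT) -> /(_ isT).
by move: gn; case: (g n); case: (g' n).
Qed.

Lemma charf_inj : injective charf.
Proof.
move=> x y xy; apply/seteqP; split=> k.
  by move/mem_set => xk; apply/set_mem; rewrite -[_ \in _]/(charf y k) -xy.
by move/mem_set => xk; apply/set_mem; rewrite -[_ \in _]/(charf x k) xy.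
Qed.

Lemma card_continuum (B : set cantor_space) :
  [set: cantor_space] #<= B -> B #= [set: set nat].
Proof.
move=> Bbig; rewrite card_eq_le; apply/andP; split.
  apply: (card_le_trans (card_leT B)); apply/setT_card_leP.
  exists (fun f => [set k | f k]) => // f g fg.
  by apply: funext => k; apply/idP/idP; have := congr1 (@^~ k) fg => /= ->.
apply: card_le_trans Bbig; apply/setT_card_leP.
by exists charf => //; exact: charf_inj.
Qed.

Lemma cantor_space_uncountable : ~ countable [set: cantor_space].
Proof.
move=> /setT_card_leP[f finj _].
(* The diagonal argument: d disagrees with itself at f d. *)
pose d : cantor_space := fun n => `[< exists2 g, f g = n & ~~ g n >].
case Ed: (d (f d)).
  by have /asboolP[g /finj ->] := Ed; rewrite Ed.
by move/negP: (Ed); apply; apply/asboolP; exists d; rewrite ?Ed.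
Qed.

(** * A closed independent family *)

(** The classical independent family of Fichtenholz, Kantorovich and Hausdorff.
    It lives on the countable set of pairs [(n, W)], with [W] a finite set of
    words, and [f] selects the pairs for which [W] contains the initial segment
    of [f] of length [n].  These pairs are coded by natural numbers through
    [pickle]; numbers coding no pair belong to no [indep f]. *)
Definition indepb (f : cantor_space) (k : nat) : bool :=
  if @unpickle (nat * seq (seq bool))%type k is Some (n, W)
  then mkseq f n \in W else false.

Definition indep (f : cantor_space) : set nat := [set k | indepb f k].

Definition Phi (f : cantor_space) : cantor_space := charf (indep f).

Lemma PhiE f : Phi f = indepb f.
Proof. by apply: funext => k; exact: asboolb. Qed.

Lemma eventually_separated (D : seq cantor_space) :
  exists n0, forall n, n0 <= n ->
    {in D &, injective (fun f : cantor_space => mkseq f n)}.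
Proof.
have sep (fg : cantor_space * cantor_space) :
    exists k, fg.1 <> fg.2 -> fg.1 k <> fg.2 k.
  have [fg12|fg12] := pselect (fg.1 = fg.2); first by exists 0.
  have /existsNP[k fgk] : ~ forall k, fg.1 k = fg.2 k.
    by move=> /funext.
  by exists k.
have [N NP] := choice sep.
exists (\max_(fg <- [seq (f, g) | f <- D, g <- D]) (N fg).+1).
move=> n n0n f g fD gD fgn; apply: contrapT => fg; apply: (NP (f, g) fg) => /=.
have Nn : N (f, g) < n.
  apply: leq_trans n0n.
  apply: (@leq_bigmax_seq _ _ xpredT (fun fg => (N fg).+1)) => //.
  exact: allpairs_f.
by rewrite -(nth_mkseq false f Nn) fgn nth_mkseq.
Qed.

(** Once [n] is so large that the members of [D] have distinct initial segments
    of length [n], the pair of [n] and of the set of the initial segments of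
    those [f] with [b f] realises the pattern [b]. *)
Lemma indep_independent (D : seq cantor_space) (b : cantor_space -> bool) :
  infinite_set [set k | forall f, f \in D -> Phi f k = b f].
Proof.
have [n0 sepD] := eventually_separated D.
pose code n := pickle ((n0 + n)%N, [seq mkseq f (n0 + n) | f <- D & b f]).
apply/infiniteP/setT_card_leP; exists code.
  by move=> m n /(pcan_inj pickleK)[/addnI].
move=> n f fD; rewrite PhiE /indepb pickleK; apply/idP/idP => [/mapP[g]|bf].
  by rewrite mem_filter => /andP[bg gD] /sepD -> //; exact: leq_addr.
by apply: map_f; rewrite mem_filter bf.
Qed.

Lemma Phi_inj : injective Phi.
Proof.
move=> f g fg; apply: contrapT => /eqP fneg.
have [k kP] := infinite_setN0 (@indep_independent [:: f; g] (pred1 f)).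
have := kP f; have := kP g; rewrite !inE !eqxx orbT fg /= => -> // /(_ isT).
by rewrite eq_sym (negPf fneg).
Qed.

Lemma Phi_continuous : continuous Phi.
Proof.
move=> f; apply: cvg_coord => k.
case E: (@unpickle (nat * seq (seq bool))%type k) => [[n W]|]; last first.
  by apply: (@filterS _ (nbhs f)) filterT => g _ /=; rewrite !PhiE /indepb E.
apply: (@filterS _ (nbhs f)) (nbhs_cylinder f n) => g gf /=.
rewrite !PhiE /indepb E.
have -> // : mkseq g n = mkseq f n.
by apply/eq_in_map => i; rewrite mem_iota => /gf.
Qed.

Lemma closed_range_Phi : closed (range Phi).
Proof.
apply: compact_closed; first exact: cantor_space_hausdorff.
apply: continuous_compact; last exact: cantor_space_compact.
exact/continuous_subspaceT/Phi_continuous.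
Qed.

(** A closed set is the set of branches of the tree of the initial segments of
    its members, and such a tree is a point of the Cantor space once words are
    coded by numbers.  So the perfect sets included in [range Phi] are indexed
    by the Cantor space, and [bernstein] applies to their preimages.  Indices
    whose set of branches is too small are harmlessly assigned the whole
    space. *)
Lemma bernstein_indep : exists2 B : set cantor_space,
  [set: cantor_space] #<= B &
  forall P, P !=set0 -> perfect_set P -> ~ P `<=` Phi @` B.
Proof.
pose T (f : cantor_space) : set cantor_space :=
  [set g | forall n, f (pickle (mkseq (Phi g) n))].
pose Q f := if `[< [set: bool * cantor_space] #<= T f >] then T f else setT.
have big : [set: bool * cantor_space] #<= [set: cantor_space].
  apply/setT_card_leP.
  exists (fun bf n => if n is n'.+1 then bf.2 n' else bf.1) => // -[b f] [c g] e.
  congr (_, _); first exact: (congr1 (@^~ 0) e).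
  by apply: funext => n; exact: (congr1 (@^~ n.+1) e).
have [|B Bbig BQ] := @bernstein cantor_space cantor_space Q.
  by move=> f; rewrite /Q; case: asboolP.
exists B => // P P0 Pperf PB.
(* f codes the tree of P; the length of a word is read off from its code. *)
pose f : cantor_space := fun k => `[< exists2 g, P g &
  k = pickle (mkseq g (size (odflt [::] (@unpickle (seq bool) k)))) >].
have TP : T f = Phi @^-1` P.
  apply/seteqP; split=> g /= gP.
    apply: closed_cylinder => [|n]; first by case: Pperf.
    have /asboolP[h Ph] := gP n; rewrite pickleK /= size_mkseq.
    move=> /(pcan_inj pickleK) gh; exists h => // k kn.
    by rewrite -(nth_mkseq false h kn) -gh nth_mkseq.
  by move=> n; apply/asboolP; exists (Phi g) => //; rewrite pickleK /= size_mkseq.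
apply: (BQ f); rewrite /Q asboolT TP.
  by move=> g /PB[h Bh /Phi_inj <-].
apply: card_le_trans big _; apply: card_le_trans (perfect_set_card P0 Pperf) _.
apply: card_le_trans (card_image_le Phi _); apply: subset_card_le => y Py.
by have [g _ gy] := PB y Py; exists g => //=; rewrite gy.
Qed.

(** * The ultrafilter *)

(** For finite [D], let [C_D] be the Boolean combination of the [indep f], with
    [f] in [D], prescribed by [B].  The filter [F] below consists of the sets
    [y] that, for some [D], almost contain [C_D] outside [indep g] whenever [g]
    belongs to [E] but not to [D].  Independence makes [F] proper.  It contains
    [indep f] or its complement as [B] prescribes (take [D] to be the singleton
    of [f]), and also the complement of every pseudointersection of
    [indep @` E] (take [D] empty), so no ultrafilter above [F] is a P-point. *)
Lemma indep_ultrafilter (B E : set cantor_space) :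
  infinite_set E -> countable E -> E `<=` B ->
  exists U : set_system nat,
    [/\ UltraFilter U, ~ P_point U & forall f, U (indep f) <-> B f].
Proof.
move=> Einf Ecount EB.
pose b f := f \in B.
(* Q D g y is the set of the points of C_D outside indep g that y misses. *)
pose Q (D : seq cantor_space) g (y : set nat) :=
  [set k | forall f, f \in D -> Phi f k = b f] `\` indep g `\` y.
pose F : set_system nat := [set y |
  exists D, forall g, E g -> g \notin D -> finite_set (Q D g y)].
have FF : ProperFilter F.
  apply: Build_ProperFilter_ex.
    move=> y [D Dy]; apply: contrapT => /forallNP y0.
    have [g [Eg gD]] : exists g, E g /\ g \notin D.
      apply: contrapT => /forallNP ED; apply: Einf.
      apply: (sub_finite_set _ (finite_seq D)) => g Eg /=.
      by apply: contrapT => /negP gD; exact: (ED g).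
    (* The pattern prescribed by B on D, and membership denied for g. *)
    apply: (@indep_independent (g :: D) (fun f => (f != g) && b f)).
    apply: sub_finite_set (Dy g Eg gD) => k kP; split; last exact: y0.
    split => [f fD|gk].
      by rewrite kP ?inE ?fD ?orbT //; case: eqP fD gD => [->|] // ->.
    have := kP g; rewrite inE eqxx => /(_ isT) /=; rewrite /Phi /charf.
    by move/negP; rewrite in_setE.
  split.
  - by exists [::] => g _ _; apply: sub_finite_set (finite_set0 _) => k [_ []].
  - move=> y z [D Dy] [D' Dz]; exists (D ++ D') => g Eg.
    rewrite mem_cat negb_or => /andP[gD gD'].
    apply: (@sub_finite_set _ _ (Q D g y `|` Q D' g z)); last first.
      by rewrite finite_setU; split; [exact: Dy|exact: Dz].
    move=> k [[kP gk] /not_andP[yk|zk]]; [left|right]; split => //; split => //.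
      by move=> f fD; apply: kP; rewrite mem_cat fD.
    by move=> f fD; apply: kP; rewrite mem_cat fD orbT.
  - move=> y z yz [D Dy]; exists D => g Eg /(Dy g Eg); apply: sub_finite_set.
    by move=> k [kP zk]; split => // /yz.
have [U [UU FU]] := ultraFilterLemma FF.
have UB f : B f -> U (indep f).
  move=> Bf; apply: FU; exists [:: f] => g _ _.
  apply: sub_finite_set (finite_set0 _) => k [[/(_ f)]].
  rewrite inE eqxx => /(_ isT) + _; rewrite /b mem_set // => fk.
  by apply; move: fk => /set_mem.
have UnB f : ~ B f -> U (~` indep f).
  move=> Bf; apply: FU; exists [:: f] => g _ _.
  apply: sub_finite_set (finite_set0 _) => k [[/(_ f)]].
  rewrite inE eqxx => /(_ isT) + _; rewrite /b memNset // => fk.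
  by apply; move: fk => /negbT /negP; rewrite in_setE.
have Udisj y : U y -> U (~` y) -> False.
  by move=> Uy Uny; have [k []] := filter_ex (filterI Uy Uny).
exists U; split => //; last first.
  by move=> f; split => [Uf|]; [apply: contrapT => /UnB; exact: Udisj|exact: UB].
move=> [_ _ /(_ (indep @` E))[||z Uz zE]].
- by apply: card_le_trans (card_image_le _ _) Ecount.
- by move=> _ [f /EB/UB ? <-].
- apply: (Udisj z Uz); apply: FU; exists [::] => g Eg _.
  apply: sub_finite_set (zE _ _); last by exists g.
  by move=> k [[_ gk] /contrapT zk].
Qed.

Theorem theorem45 :
  exists U : set_system nat,
    [/\ UltraFilter U,
        ~ P_point U
      & exists A : set cantor_space,
          [/\ closed_in (in_cantor U) A,
              has_card_continuum A
            & ~ perfect_set_property A]].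
Proof.
have [B Bbig Bperf] := bernstein_indep.
have Binf : [set: nat] #<= B.
  apply/infiniteP => Bfin; apply: cantor_space_uncountable.
  exact: card_le_trans Bbig (finite_set_countable Bfin).
have /setT_card_leP[e einj eB] := Binf.
have [|||U [UU UP UB]] := @indep_ultrafilter B (range e).
- by apply/infiniteP/setT_card_leP; exists e => // n; exists n.
- exact: card_image_le.
- by move=> _ [n _ <-].
have PhiB : Phi @` B = range Phi `&` in_cantor U.
  apply/seteqP; split=> [_ [f Bf <-]|_ [[f _ <-] [y Uy /charf_inj yf]]].
    by split; [exists f|exists (indep f) => //; exact/UB].
  by exists f => //; apply/UB; rewrite -yf.
exists U; split => //; exists (Phi @` B); split.
- rewrite PhiB; split; first by move=> x [].
  apply/closed_subspaceP; exists (range Phi); first exact: closed_range_Phi.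
  by rewrite -setIA setIid.
- exact: card_eq_trans (inj_card_eq (in2W Phi_inj)) (card_continuum Bbig).
- move=> [Bcount|[P [P0 Pperf PB]]]; last exact: (Bperf P).
  apply: cantor_space_uncountable; apply: card_le_trans Bcount.
  by rewrite (card_le_eqr (inj_card_eq (in2W Phi_inj))).
Qed.
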